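(* Let $K$ be a field of characteristic $0$ and let $\alpha\in K$. If $\alpha^3=1$ and the equation $\lambda^2+\lambda+1=0$ has no root in $K$, then the group of automorphisms of $E_\alpha$ consists of the automorphisms given by $$x\mapsto k_1x+k_2y+k_3z,\qquad y\mapsto k_1y+k_2z+k_3x,\qquad z\mapsto k_1z+k_2x+k_3y,$$ where $k_1,k_2,k_3\in K$ and $k_1^3+k_2^3+k_3^3-3k_1k_2k_3\neq0$.
   Context: For $\alpha\in K$ put $C=\frac13(x^3+y^3+z^3)-\alpha xyz\in K[x,y,z]$. The elliptic Poisson algebra $E_\alpha$ is the polynomial algebra $K[x,y,z]$ endowed with the Poisson bracket determined by $\{x,y\}=-\alpha xy+z^2$, $\{y,z\}=-\alpha yz+x^2$, $\{z,x\}=-\alpha zx+y^2$; equivalently $\{u,v\}=J(u,v,C)$ for all $u,v\in K[x,y,z]$, where $J(f_1,f_2,f_3)$ is the determinant of the Jacobian matrix of $(f_1,f_2,f_3)$ with respect to $(x,y,z)$. An automorphism of a Poisson algebra $P$ over $K$ is a bijective $K$-linear map $\phi:P\to P$ with $\phi(ab)=\phi(a)\phi(b)$ and $\phi(\{a,b\})=\{\phi(a),\phi(b)\}$ for all $a,b\in P$. The group of automorphisms of $E_\alpha$ is its group of automorphisms as a Poisson algebra. (Under the hypotheses of the claim, $\alpha=1$.) *)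

(* Defs.v *)
From HB Require Import structures.
From mathcomp Require Import all_boot all_order all_algebra.
From mathcomp Require Import mpoly.
From mathcomp Require Import ring.

Set Implicit Arguments.
Unset Strict Implicit.
Unset Printing Implicit Defensive.

Import GRing.Theory.
Local Open Scope ring_scope.

Record is_poisson_bracket (K : fieldType) (P : comAlgType K)
    (br : P -> P -> P) : Prop := IsPoissonBracket {
  pbr_linear : forall a, linear (br a);
  pbr_alt : forall a, br a a = 0;
  pbr_leibniz : forall a b c, br a (b * c) = br a b * c + b * br a c;
  pbr_jacobi : forall a b c, br a (br b c) + br b (br c a) + br c (br a b) = 0
}.

(* [phi 1 = 1] is not required separately: it follows from multiplicativity
   and surjectivity. *)
Record is_poisson_aut (K : fieldType) (P : comAlgType K) (br : P -> P -> P)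
    (phi : P -> P) : Prop := IsPoissonAut {
  paut_bij : bijective phi;
  paut_linear : linear phi;
  paut_mul : {morph phi : a b / a * b};
  paut_br : {morph phi : a b / br a b}
}.

Definition jacobian (K : fieldType) (n : nat) (f : 'I_n -> {mpoly K[n]}) :
    {mpoly K[n]} :=
  \det (\matrix_(i < n, j < n) (f i)^`M(j)).

Section Elliptic.

Variable K : fieldType.

Definition xvar : {mpoly K[3]} := 'X_(0 : 'I_3).
Definition yvar : {mpoly K[3]} := 'X_(1 : 'I_3).
Definition zvar : {mpoly K[3]} := 'X_(2 : 'I_3).

Local Notation x := xvar.
Local Notation y := yvar.
Local Notation z := zvar.

Definition ell_C (alpha : K) : {mpoly K[3]} :=
  3%:R^-1 *: (x ^+ 3 + y ^+ 3 + z ^+ 3) - alpha *: (x * y * z).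

Definition ell_br (alpha : K) (u v : {mpoly K[3]}) : {mpoly K[3]} :=
  jacobian (tnth [tuple u; v; ell_C alpha]).

Definition circ_subst (k1 k2 k3 : K) (p : {mpoly K[3]}) : {mpoly K[3]} :=
  p \mPo [tuple k1 *: x + k2 *: y + k3 *: z;
                k1 *: y + k2 *: z + k3 *: x;
                k1 *: z + k2 *: x + k3 *: y].

Lemma circ_substE (k1 k2 k3 : K) :
  [/\ circ_subst k1 k2 k3 x = k1 *: x + k2 *: y + k3 *: z,
      circ_subst k1 k2 k3 y = k1 *: y + k2 *: z + k3 *: x &
      circ_subst k1 k2 k3 z = k1 *: z + k2 *: x + k3 *: y].
Proof. by split; rewrite /circ_subst comp_mpolyXU. Qed.

End Elliptic.

(* The remaining lemmas check that [ell_br alpha] is a Poisson bracket with the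
   expected values on the generators. *)

Lemma det_mx33 (R : comNzRingType) (A : 'M[R]_3) :
  \det A = (A 0 1 * A 1 2 - A 0 2 * A 1 1) * A 2 0
         + (A 0 2 * A 1 0 - A 0 0 * A 1 2) * A 2 1
         + (A 0 0 * A 1 1 - A 0 1 * A 1 0) * A 2 2.
Proof.
rewrite (expand_det_row _ ord0) !big_ord_recl big_ord0 /cofactor.
rewrite !(expand_det_row _ ord0) !big_ord_recl !big_ord0 /cofactor !det_mx11.
rewrite !mxE /=.
have E1 : lift ord0 (lift ord0 ord0) = 2 :> 'I_3 by apply/val_inj.
have E0 : lift ord0 ord0 = 1 :> 'I_3 by apply/val_inj.
have E2 : lift (lift ord0 ord0) 0 = 0 :> 'I_2 by apply/val_inj.
have E3 : lift 1 (lift ord0 ord0) = 2 :> 'I_3 by apply/val_inj.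
have E4 : lift 1 ord0 = 0 :> 'I_3 by apply/val_inj.
have E5 : lift 2 ord0 = 0 :> 'I_3 by apply/val_inj.
have E6 : lift 2 (lift ord0 ord0) = 1 :> 'I_3 by apply/val_inj.
have E7 : ord0 = 0 :> 'I_3 by apply/val_inj.
rewrite !E2 !E1 !E0 ?E3 ?E4 ?E5 ?E6 ?E7 /bump /=.
ring.
Qed.

Section JacobianBracket.

Variables (R : comNzRingType) (d0 d1 d2 : R -> R) (C : R).

Let br (u v : R) : R :=
    (d1 u * d2 v - d2 u * d1 v) * d0 C
  + (d2 u * d0 v - d0 u * d2 v) * d1 C
  + (d0 u * d1 v - d1 u * d0 v) * d2 C.

Let derivation (d : R -> R) : Prop :=
  {morph d : u v / u - v} /\ forall u v, d (u * v) = d u * v + u * d v.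

Lemma jacobian_br_linear (u v w c : R) :
  (forall p q, d0 (c * p + q) = c * d0 p + d0 q) ->
  (forall p q, d1 (c * p + q) = c * d1 p + d1 q) ->
  (forall p q, d2 (c * p + q) = c * d2 p + d2 q) ->
  br u (c * v + w) = c * br u v + br u w.
Proof. by rewrite /br => -> -> ->; ring. Qed.

Lemma jacobian_br_alt (u : R) : br u u = 0.
Proof. by rewrite /br; ring. Qed.

Lemma jacobian_br_leibniz (u v w : R) :
  derivation d0 -> derivation d1 -> derivation d2 ->
  br u (v * w) = br u v * w + v * br u w.
Proof. by move=> [_ M0] [_ M1] [_ M2]; rewrite /br M0 M1 M2; ring. Qed.

Lemma jacobian_br_jacobi (u v w : R) :
  derivation d0 -> derivation d1 -> derivation d2 ->
  (forall p, d1 (d0 p) = d0 (d1 p)) -> (forall p, d2 (d0 p) = d0 (d2 p)) ->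
  (forall p, d2 (d1 p) = d1 (d2 p)) ->
  br u (br v w) + br v (br w u) + br w (br u v) = 0.
Proof.
move=> [B0 M0] [B1 M1] [B2 M2] c10 c20 c21.
have add (d : R -> R) : {morph d : p q / p - q} -> {morph d : p q / p + q}.
  move=> dB p q; have d00 : d 0 = 0 by rewrite -[X in d X](subrr 0) dB subrr.
  by rewrite -{1}(opprK q) dB -(sub0r q) dB d00 sub0r opprK.
have [[A0 A1] A2] := (add _ B0, add _ B1, add _ B2).
rewrite /br !(A0, A1, A2) !(M0, M1, M2) !(B0, B1, B2) !(M0, M1, M2).
rewrite !(c10, c20, c21).
ring.
Qed.

End JacobianBracket.

Section EllipticCheck.

Variables (K : fieldType) (alpha : K).

Local Notation x := (xvar K).
Local Notation y := (yvar K).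
Local Notation z := (zvar K).

Lemma ell_brE (u v : {mpoly K[3]}) :
  let C := ell_C alpha in
  ell_br alpha u v =
    (u^`M(1) * v^`M(2) - u^`M(2) * v^`M(1)) * C^`M(0)
  + (u^`M(2) * v^`M(0) - u^`M(0) * v^`M(2)) * C^`M(1)
  + (u^`M(0) * v^`M(1) - u^`M(1) * v^`M(0)) * C^`M(2).
Proof. by rewrite /ell_br /jacobian det_mx33 !mxE !(tnth_nth 0). Qed.

Lemma ell_br_poisson : @is_poisson_bracket K {mpoly K[3]} (ell_br alpha).
Proof.
have der (i : 'I_3) : {morph @mderiv 3 K i : u v / u - v} /\
    forall u v : {mpoly K[3]}, (u * v)^`M(i) = u^`M(i) * v + u * v^`M(i).
  by split; [apply: mderivB | apply: mderivM].
split=> [a c u v|a|a b c|a b c]; rewrite !ell_brE.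
- rewrite -!mul_mpolyC; apply: jacobian_br_linear => p q;
    by rewrite !mul_mpolyC mderivD mderivZ.
- exact: (@jacobian_br_alt {mpoly K[3]} (mderiv 0) (mderiv 1) (mderiv 2)).
- by apply: (@jacobian_br_leibniz {mpoly K[3]} (mderiv 0) (mderiv 1) (mderiv 2));
    apply: der.
- apply: (@jacobian_br_jacobi {mpoly K[3]} (mderiv 0) (mderiv 1) (mderiv 2));
    by [apply: der | move=> p; apply: mderiv_comm].
Qed.

Lemma mderiv_var (i j : 'I_3) : ('X_j : {mpoly K[3]})^`M(i) = (j == i)%:R.
Proof.
rewrite mderivX mnm1E; case: eqP => [->|_]; last by rewrite scale0r.
rewrite scale1r -mpolyX0; congr mpolyX; apply/mnmP=> k.
by rewrite mnmBE subnn mnm0E.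
Qed.

Lemma ell_C_deriv : 3%:R != 0 :> K ->
  [/\ (ell_C alpha)^`M(0) = x ^+ 2 - alpha *: (y * z),
      (ell_C alpha)^`M(1) = y ^+ 2 - alpha *: (z * x) &
      (ell_C alpha)^`M(2) = z ^+ 2 - alpha *: (x * y)].
Proof.
move=> n3.
have cube (p q : {mpoly K[3]}) : q = p *+ 3 -> 3%:R^-1 *: q = p.
  by move=> ->; rewrite -scaler_nat scalerA mulVf // scale1r.
rewrite /ell_C !mderivB !mderivZ !mderivD !exprS !expr0 !mulr1 !mderivM.
rewrite !mderiv_var /= !(mulr0, mul0r, mulr1, mul1r, addr0, add0r).
split; congr (_ - _ *: _); first [exact: mulrC | apply: cube].
- by rewrite mulrDr addrA -!mulr2n -mulrSr.
- by rewrite mulrDr addrA -!mulr2n -mulrSr.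
- by rewrite mulrDr addrA -!mulr2n -mulrSr.
Qed.

Lemma ell_br_gens : [pchar K] =i pred0 ->
  [/\ ell_br alpha x y = - alpha *: (x * y) + z ^+ 2,
      ell_br alpha y z = - alpha *: (y * z) + x ^+ 2 &
      ell_br alpha z x = - alpha *: (z * x) + y ^+ 2].
Proof.
move=> /pcharf0P K0; have [] := ell_C_deriv; first by rewrite K0.
rewrite !ell_brE => -> -> ->.
rewrite !mderiv_var /= !(mulr0, mul0r, mulr1, subr0, mul1r, oppr0, addr0, add0r).
by split; rewrite scaleNr addrC.
Qed.

End EllipticCheck.

(* Main.v *)
Require Import Defs.
From HB Require Import structures.
From mathcomp Require Import all_boot all_order all_algebra all_field.
From mathcomp Require Import mpoly.
From mathcomp Require Import ring zify.
Import GRing.Theory.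
Local Open Scope ring_scope.

Set Implicit Arguments.
Unset Strict Implicit.
Unset Printing Implicit Defensive.

(** Since [K] has no primitive cube root of unity, [alpha ^+ 3 = 1] forces
    [alpha = 1], and then [3 C = x^3 + y^3 + z^3 - 3xyz] is a product of three
    linear forms over the extension [L = K(w)], [w ^+ 2 + w + 1 = 0]: these are
    [u_i = x + w^i y + w^(2i) z].  In the coordinates [u_0, u_1, u_2] the
    bracket becomes, up to a scalar, the log-canonical bracket
    [{u_i, u_(i+1)} = u_i u_(i+1)] ([theta_br]).

    The main point is that every automorphism of the log-canonical bracket maps
    each coordinate to a scalar multiple of a coordinate ([log_aut_monomial]).
    If [U] is the image of a coordinate, then [U] divides every bracket
    [{X_j, U}], because a coordinate divides all its own brackets and the
    automorphism is onto.  Now [{X_j, U} = X_j * d_j U], where [d_j] is diagonal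
    on monomials, with eigenvalues differences of exponents.  If no [X_j]
    divides [U], then [U] divides [d_j U], which has no larger degree, so [U] is
    an eigenvector of every [d_j]; since some monomial of [U] avoids any given
    variable, all eigenvalues vanish and [U] is central, which is absurd.  So
    some [X_j] divides [U], and [U] is irreducible.

    An automorphism over [K] extends to [L[u_0, u_1, u_2]], so it maps [x, y, z]
    to linear forms ([aut_var_lform]).  It maps [u_0 = x + y + z] to a multiple
    of some [u_j] with coefficients in [K]; as [w] is not in [K], it maps [u_0]
    to a multiple of itself ([aut_sum_var]).  Hence it commutes with the
    derivation [{u_0, -} / u_0], and linear maps with these two properties are
    circulant ([aut_circulant]).

    Conversely the substitution with parameters [k1, k2, k3] multiplies [C] by
    the circulant determinant [N] and has Jacobian determinant [N], so by the
    chain rule it preserves the bracket as soon as [N != 0]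
    ([circ_subst_aut]).  The same identity shows that [N != 0] for every
    automorphism, since [C] cannot be mapped to [0]. *)

(** * Polynomial rings: generators, variables and Euler operators *)

Lemma forall_ord3 (P : 'I_3 -> Prop) : P 0 -> P 1 -> P 2 -> forall i, P i.
Proof.
move=> P0 P1 P2 [[|[|[|//]]] lti].
- by have -> : Ordinal lti = 0 by apply: val_inj.
- by have -> : Ordinal lti = 1 by apply: val_inj.
- by have -> : Ordinal lti = 2 by apply: val_inj.
Qed.

Lemma sum_ord3 (V : nmodType) (f : 'I_3 -> V) : \sum_i f i = f 0 + f 1 + f 2.
Proof.
rewrite !big_ord_recl big_ord0 addr0 addrA.
by congr (f _ + f _ + f _); apply: val_inj.
Qed.

Section Generators.

Variables (n : nat) (R : comNzRingType).
Implicit Types (p q : {mpoly R[n]}) (m : 'X_{1..n}).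

Lemma mpoly_gen_ind (P : {mpoly R[n]} -> Prop) :
    (forall c, P c%:MP) -> (forall i, P 'X_i) ->
    (forall p q, P p -> P q -> P (p + q)) ->
    (forall p q, P p -> P q -> P (p * q)) ->
  forall p, P p.
Proof.
move=> PC PX PD PM p; elim/mpolyind: p => [|c m p _ _ Pp]; first exact: PC.
apply: PD => //; rewrite -mul_mpolyC mpolyXE_id; apply: (PM) => //.
have P1 : P 1 by rewrite -mpolyC1.
apply: big_rec => // i q _ Pq; apply: (PM) => //.
by elim: (m i) => [|k IHk]; rewrite ?expr0 ?exprS //; apply: (PM).
Qed.

Lemma mpoly_rmorph_ext (S : nzRingType) (F G : {rmorphism {mpoly R[n]} -> S}) :
  (forall c, F c%:MP = G c%:MP) -> (forall i, F 'X_i = G 'X_i) -> F =1 G.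
Proof.
move=> FGC FGX; elim/mpoly_gen_ind => // p q Fp Fq.
- by rewrite !rmorphD Fp Fq.
- by rewrite !rmorphM Fp Fq.
Qed.

(** A derivation along [F] is determined by its values on the generators; this
    turns identities between brackets into identities between brackets of
    variables. *)
Lemma derivation_eq0 (S : comNzRingType) (F D : {mpoly R[n]} -> S) :
    {morph D : p q / p + q} ->
    (forall p q, D (p * q) = D p * F q + F p * D q) ->
    (forall c, D c%:MP = 0) -> (forall i, D 'X_i = 0) ->
  forall p, D p = 0.
Proof.
move=> DD DM DC DX; elim/mpoly_gen_ind => // p q Dp Dq.
- by rewrite DD Dp Dq addr0.
- by rewrite DM Dp Dq mul0r mulr0 addr0.
Qed.

(** The remainder is the value at ['X_j = 0], a ring morphism in [p]: this is
    what makes ['X_j] a prime element. *)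
Lemma mpoly_var_remainder (j : 'I_n) p :
  exists q, p = p \mPo [tuple if i == j then 0 else 'X_i | i < n] + 'X_j * q.
Proof.
elim/mpoly_gen_ind: p => [c|i|p q [p' Ep] [q' Eq]|p q [p' Ep] [q' Eq]].
- by exists 0; rewrite comp_mpolyC mulr0 addr0.
- rewrite comp_mpolyXU -tnth_nth tnth_mktuple.
  case: eqP => [->|_]; first by exists 1; rewrite add0r mulr1.
  by exists 0; rewrite mulr0 addr0.
- by exists (p' + q'); rewrite rmorphD /= {1}Ep {1}Eq; ring.
- exists (p' * q + (p \mPo [tuple if i == j then 0 else 'X_i | i < n]) * q').
  by rewrite rmorphM /= {1}Ep {1}Eq {3}Eq; ring.
Qed.

(** A boolean form of divisibility, to split on whether some variable divides a
    given polynomial. *)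
Definition var_dvd (j : 'I_n) p :=
  all (fun m : 'X_{1..n} => 0 < m j)%N (msupp p).

Lemma var_dvdP (j : 'I_n) p : reflect (exists q, p = 'X_j * q) (var_dvd j p).
Proof.
apply: (iffP allP) => [pj|[q ->] m].
  exists (\sum_(m <- msupp p) p@_m *: 'X_[m - U_(j)]).
  rewrite {1}[p]mpolyE mulr_sumr; apply: eq_big_seq => m /pj mj.
  by rewrite -scalerAr -mpolyXD addmC submK // lep1mP -lt0n.
rewrite mulrC (perm_mem (msuppMX _ _)) => /mapP[k _ ->].
by rewrite mnmDE mnm1E eqxx.
Qed.

(** The Euler operators are diagonal in the basis of monomials. *)
Lemma mcoeff_euler (i : 'I_n) p m : ('X_i * p^`M(i))@_m = p@_m *+ m i.
Proof.
elim/mpolyind: p => [|c k p _ _ IHp].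
  by rewrite mderiv0 mulr0 mcoeff0 mul0rn.
rewrite mderivD mulrDr !mcoeffD IHp mderivZ mderivX mulrnDl; congr (_ + _).
case: (posnP (k i)) => [k0|k_gt0].
  rewrite k0 scale0r scaler0 mulr0 mcoeff0 mcoeffZ mcoeffX.
  by case: eqP => [<-|_]; rewrite ?k0 ?mulr0n // mulr0 mul0rn.
rewrite -!scalerAr -mpolyXD addmC submK ?lep1mP -?lt0n //.
rewrite !mcoeffZ mcoeffX; case: eqP => [->|_]; last by rewrite !mulr0 mul0rn.
by rewrite !mulr1 mulr_natr.
Qed.

End Generators.

(** * Linear forms in three variables *)

Definition lform (K : fieldType) (a : 'I_3 -> K) : {mpoly K[3]} :=
  \sum_k a k *: 'X_k.

Lemma mcoeff_lform (K : fieldType) (a : 'I_3 -> K) k : (lform a)@_U_(k) = a k.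
Proof.
rewrite raddf_sum (bigD1 k) //= big1 => [|l lk]; rewrite mcoeffZ mcoeffXU.
  by rewrite eqxx mulr1 addr0.
by rewrite (negPf lk) mulr0.
Qed.

Lemma lformD (K : fieldType) (a b : 'I_3 -> K) :
  lform a + lform b = lform (fun k => a k + b k).
Proof. by rewrite -big_split; apply: eq_bigr => k _; rewrite scalerDl. Qed.

Lemma lformZ (K : fieldType) (c : K) (a : 'I_3 -> K) :
  c *: lform a = lform (fun k => c * a k).
Proof. by rewrite scaler_sumr; apply: eq_bigr => k _; rewrite scalerA. Qed.

(** Being a linear form descends along a field extension, because
    coefficients do. *)
Lemma lform_descent (K L : fieldType) (iota : {rmorphism K -> L}) p
    (a : 'I_3 -> L) :
  map_mpoly iota p = lform a -> p = lform (fun k => p@_U_(k)).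
Proof.
move=> E; have Ea k : a k = iota p@_U_(k).
  by rewrite -mcoeff_map_mpoly E mcoeff_lform.
apply/mpolyP=> m; apply: (fmorph_inj iota).
rewrite -mcoeff_map_mpoly E !raddf_sum /=; apply: eq_bigr => k _.
by rewrite !mcoeffZ rmorphM /= Ea !mcoeffX rmorph_nat.
Qed.

(** * Jacobian brackets *)

Section ChainRule.

Variables (K L : fieldType) (n m : nat).
Variable F : {rmorphism {mpoly K[n]} -> {mpoly L[m]}}.
Hypothesis FC : forall c j, (F c%:MP)^`M(j) = 0.

(** Chain rule for a morphism that maps constants to constants. *)
Lemma mderiv_rmorph (p : {mpoly K[n]}) j :
  (F p)^`M(j) = \sum_i F (p^`M(i)) * (F 'X_i)^`M(j).
Proof.
elim/mpoly_gen_ind: p => [c|k|p q Ep Eq|p q Ep Eq].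
- by rewrite FC big1 // => i _; rewrite mderivC rmorph0 mul0r.
- rewrite (bigD1 k) //= big1 => [|i ik]; rewrite mderivX mnm1E.
    have -> : (U_(k) - U_(k) = 0)%MM.
      by apply/mnmP=> l; rewrite mnmBE subnn mnm0E.
    by rewrite eqxx scale1r mpolyX0 rmorph1 mul1r addr0.
  by rewrite eq_sym (negPf ik) scale0r rmorph0 mul0r.
- rewrite rmorphD mderivD Ep Eq -big_split; apply: eq_bigr => i _ /=.
  by rewrite mderivD rmorphD mulrDl.
- rewrite rmorphM mderivM Ep Eq mulr_suml mulr_sumr -big_split.
  apply: eq_bigr => i _ /=; rewrite mderivM rmorphD !rmorphM /=; ring.
Qed.

End ChainRule.

Definition jac3 (K : fieldType) (u v w : {mpoly K[3]}) : {mpoly K[3]} :=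
  jacobian (tnth [tuple u; v; w]).

Section Jacobian3.

Lemma jac3E (K : fieldType) (u v w : {mpoly K[3]}) : jac3 u v w =
    (u^`M(1) * v^`M(2) - u^`M(2) * v^`M(1)) * w^`M(0)
  + (u^`M(2) * v^`M(0) - u^`M(0) * v^`M(2)) * w^`M(1)
  + (u^`M(0) * v^`M(1) - u^`M(1) * v^`M(0)) * w^`M(2).
Proof. by rewrite /jac3 /jacobian det_mx33 !mxE !(tnth_nth 0). Qed.

(** The chain rule multiplies Jacobian matrices, hence their determinants. *)
Lemma jac3_rmorph (K L : fieldType)
    (F : {rmorphism {mpoly K[3]} -> {mpoly L[3]}}) (u v w : {mpoly K[3]}) :
    (forall c j, (F c%:MP)^`M(j) = 0) ->
  jac3 (F u) (F v) (F w) = F (jac3 u v w) * jac3 (F 'X_0) (F 'X_1) (F 'X_2).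
Proof.
move=> FC; rewrite /jac3 /jacobian -det_map_mx -det_mulmx; congr (\det _).
apply/matrixP=> i j; rewrite !mxE.
have -> : tnth [tuple F u; F v; F w] i = F (tnth [tuple u; v; w] i).
  by elim/forall_ord3: i; rewrite !(tnth_nth 0).
rewrite mderiv_rmorph //; apply: eq_bigr => k _; rewrite !mxE; congr (_ * _).
by elim/forall_ord3: k; rewrite !(tnth_nth 0).
Qed.

End Jacobian3.

Section Jac3Biderivation.

Variable K : fieldType.
Implicit Types u v w : {mpoly K[3]}.

Lemma jac3_alt u v w : jac3 u v w = - jac3 v u w.
Proof. by rewrite !jac3E; ring. Qed.

Lemma jac3D u w : {morph (fun v => jac3 u v w) : v1 v2 / v1 + v2}.
Proof. by move=> v1 v2; rewrite !jac3E !mderivD; ring. Qed.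

Lemma jac3M u w v1 v2 :
  jac3 u (v1 * v2) w = jac3 u v1 w * v2 + v1 * jac3 u v2 w.
Proof. by rewrite !jac3E !mderivM; ring. Qed.

Lemma jac3C u w c : jac3 u c%:MP w = 0.
Proof. by rewrite !jac3E !mderivC; ring. Qed.

Lemma jac3Zr u v w c : jac3 u v (c *: w) = c *: jac3 u v w.
Proof. by rewrite !jac3E !mderivZ -!scalerAr -!scalerDr. Qed.

End Jac3Biderivation.

(** * Circulant substitutions *)

Section Circulant.

Variable K : fieldType.
Hypothesis charK0 : [pchar K] =i pred0.
Implicit Types (k l c : K) (p u v : {mpoly K[3]}).

Local Notation x := (xvar K).
Local Notation y := (yvar K).
Local Notation z := (zvar K).

(** The determinant of the circulant matrix with first row [k1, k2, k3]. *)
Definition circ_norm (k1 k2 k3 : K) : K :=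
  k1 ^+ 3 + k2 ^+ 3 + k3 ^+ 3 - 3%:R * k1 * k2 * k3.

HB.instance Definition _ (k1 k2 k3 : K) :=
  GRing.RMorphism.copy (@circ_subst K k1 k2 k3)
    (comp_mpoly [tuple k1 *: x + k2 *: y + k3 *: z;
                k1 *: y + k2 *: z + k3 *: x;
                k1 *: z + k2 *: x + k3 *: y]).

Lemma circ_substC k1 k2 k3 (c : K) : circ_subst k1 k2 k3 c%:MP = c%:MP.
Proof. exact: comp_mpolyC. Qed.

Lemma circ_substZ k1 k2 k3 (c : K) p :
  circ_subst k1 k2 k3 (c *: p) = c *: circ_subst k1 k2 k3 p.
Proof. exact: comp_mpolyZ. Qed.

Lemma ell_C1E : ell_C 1 = 3%:R^-1 *: (x ^+ 3 + y ^+ 3 + z ^+ 3)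
  - x * y * z.
Proof. by rewrite /ell_C scale1r. Qed.

Lemma three_neq0 : 3%:R != 0 :> K.
Proof. by rewrite (iffLR (pcharf0P K) charK0). Qed.

Lemma two_neq0 : 2%:R != 0 :> K.
Proof. by rewrite (iffLR (pcharf0P K) charK0). Qed.

(** [3 C] is the determinant of the circulant matrix of [x, z, y], and the
    substitution multiplies that matrix by the one of [k1, k2, k3]. *)
Lemma circ_subst_ell_C (k1 k2 k3 : K) :
  circ_subst k1 k2 k3 (ell_C 1) = circ_norm k1 k2 k3 *: ell_C 1.
Proof.
apply: (scalerI three_neq0).
have E3 : 3%:R *: ell_C 1 = x ^+ 3 + y ^+ 3 + z ^+ 3 - 3%:R * (x * y * z).
  rewrite ell_C1E scalerBr scalerA mulfV ?three_neq0 // scale1r.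
  by rewrite -mul_mpolyC rmorph_nat.
rewrite -circ_substZ scalerA mulrC -scalerA E3 /circ_norm.
rewrite rmorphB !rmorphD !rmorphXn !rmorphM rmorph_nat /=.
have [-> -> ->] := circ_substE k1 k2 k3.
rewrite -!mul_mpolyC !(rmorphB, rmorphD, rmorphXn, rmorphM, rmorph_nat) /=.
ring.
Qed.

Lemma circ_subst_jac3 (k1 k2 k3 : K) :
  jac3 (circ_subst k1 k2 k3 x) (circ_subst k1 k2 k3 y) (circ_subst k1 k2 k3 z)
  = (circ_norm k1 k2 k3)%:MP.
Proof.
have [-> -> ->] := circ_substE k1 k2 k3.
rewrite jac3E !mderivD !mderivZ !mderiv_var /= -!mul_mpolyC /circ_norm.
rewrite !(rmorphB, rmorphD, rmorphXn, rmorphM, rmorph_nat) /=.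
ring.
Qed.

(** Both sides agree after multiplication by the norm: on one side it is the
    Jacobian determinant of the substitution, on the other the factor by which
    [ell_C 1] is multiplied. *)
Lemma circ_subst_br (k1 k2 k3 : K) : circ_norm k1 k2 k3 != 0 ->
  {morph circ_subst k1 k2 k3 : u v / ell_br 1 u v}.
Proof.
move=> N0 u v; apply: (scalerI N0); rewrite -[LHS]mul_mpolyC mulrC.
rewrite -circ_subst_jac3.
rewrite -[ell_br 1 u v]/(jac3 u v (ell_C 1)).
rewrite -jac3_rmorph; last by move=> c j /=; rewrite circ_substC mderivC.
by rewrite /= circ_subst_ell_C jac3Zr.
Qed.

(** Substitutions compose as elements of the group algebra of the cyclic group
    of order three multiply. *)
Lemma circ_subst_comp (k1 k2 k3 l1 l2 l3 : K) p :
  circ_subst k1 k2 k3 (circ_subst l1 l2 l3 p) =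
  circ_subst (k1 * l1 + k2 * l3 + k3 * l2) (k1 * l2 + k2 * l1 + k3 * l3)
             (k1 * l3 + k2 * l2 + k3 * l1) p.
Proof.
set F := circ_subst _ _ _; set G := circ_subst _ _ _; set H := circ_subst _ _ _.
suff: F \o G =1 H by apply.
apply: (@mpoly_rmorph_ext 3 K _ (F \o G) H) => [c|i] /=.
  by rewrite /F /G /H !circ_substC.
have [Fx Fy Fz] := circ_substE k1 k2 k3.
have [Gx Gy Gz] := circ_substE l1 l2 l3; rewrite -/G in Gx Gy Gz.
have [Hx Hy Hz] := circ_substE (k1 * l1 + k2 * l3 + k3 * l2)
  (k1 * l2 + k2 * l1 + k3 * l3) (k1 * l3 + k2 * l2 + k3 * l1).
rewrite -/H in Hx Hy Hz.
have var3 : [/\ F (G x) = H x, F (G y) = H y & F (G z) = H z].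
  rewrite Gx Gy Gz Hx Hy Hz /F !rmorphD /= !circ_substZ Fx Fy Fz.
  rewrite -!mul_mpolyC !(rmorphD, rmorphM) /=.
  by split; ring.
by case: var3 => *; elim/forall_ord3: i.
Qed.

Lemma circ_subst_id (p : {mpoly K[3]}) : circ_subst 1 0 0 p = p.
Proof.
suff: circ_subst (1 : K) 0 0 =1 idfun by apply.
apply: (@mpoly_rmorph_ext 3 K _ (circ_subst 1 0 0) idfun) => [c|i] /=.
  exact: circ_substC.
have [Ex Ey Ez] := circ_substE (1 : K) 0 0.
by move: Ex Ey Ez; rewrite !scale1r !scale0r !addr0; elim/forall_ord3: i.
Qed.

Lemma circ_subst_bij (k1 k2 k3 : K) : circ_norm k1 k2 k3 != 0 ->
  bijective (circ_subst k1 k2 k3).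
Proof.
set N := circ_norm k1 k2 k3 => N0.
(* First row of the adjugate of the circulant matrix. *)
pose a1 := k1 ^+ 2 - k2 * k3; pose a2 := k3 ^+ 2 - k1 * k2.
pose a3 := k2 ^+ 2 - k1 * k3.
have E1 : k1 * a1 + k2 * a3 + k3 * a2 = N.
  by rewrite /N /circ_norm /a1 /a2 /a3; ring.
have E2 : k1 * a2 + k2 * a1 + k3 * a3 = 0 by rewrite /a1 /a2 /a3; ring.
have E3 : k1 * a3 + k2 * a2 + k3 * a1 = 0 by rewrite /a1 /a2 /a3; ring.
exists (circ_subst (a1 / N) (a2 / N) (a3 / N)) => p; rewrite circ_subst_comp.
  rewrite -[RHS]circ_subst_id !(mulrC (_ / N)) !mulrA.
  rewrite -!mulrDl.
  rewrite (_ : k1 * a1 + k3 * a2 + k2 * a3 = N); last by rewrite -E1; ring.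
  rewrite (_ : k2 * a1 + k1 * a2 + k3 * a3 = 0); last by rewrite -E2; ring.
  rewrite (_ : k3 * a1 + k2 * a2 + k1 * a3 = 0); last by rewrite -E3; ring.
  by rewrite divff // !mul0r.
rewrite -[RHS]circ_subst_id !mulrA -!mulrDl E1 E2 E3.
by rewrite divff // !mul0r.
Qed.

Lemma circ_subst_aut (k1 k2 k3 : K) (phi : {mpoly K[3]} -> {mpoly K[3]}) :
    circ_norm k1 k2 k3 != 0 -> phi =1 circ_subst k1 k2 k3 ->
  @is_poisson_aut K {mpoly K[3]} (ell_br 1) phi.
Proof.
move=> N0 Ephi; split.
- exact: eq_bij (circ_subst_bij N0) _ (fsym Ephi).
- by move=> c u v; rewrite !Ephi rmorphD /= circ_substZ.
- by move=> u v; rewrite !Ephi rmorphM.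
- by move=> u v; rewrite !Ephi circ_subst_br.
Qed.

Lemma ell_C1_neq0 : ell_C 1 != 0 :> {mpoly K[3]}.
Proof.
(* Evaluation at the point (1, 0, 0), where C takes the value 1/3. *)
apply/eqP => /(congr1 (meval (fun i => (i == 0)%:R))).
rewrite ell_C1E -!mul_mpolyC !(rmorphB, rmorphD, rmorphXn, rmorphM) /=.
rewrite meval0 mevalC !mevalXU /= !expr0n /= expr1n.
rewrite !(mulr0, mulr1, addr0, subr0).
by move/eqP; rewrite invr_eq0 (negPf three_neq0).
Qed.

End Circulant.

(** * Automorphisms of the log-canonical bracket *)

Section LogCanonical.

Variable L : fieldType.
Hypothesis charL0 : [pchar L] =i pred0.

Implicit Types u v : {mpoly L[3]}.

(** The bracket with [{X_0, X_1} = X_0 X_1] and its cyclic images. *)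
Definition log_br u v := jac3 u v ('X_0 * 'X_1 * 'X_2).

Lemma log_br_alt u v : log_br u v = - log_br v u.
Proof. exact: jac3_alt. Qed.

Lemma log_brD u v1 v2 : log_br u (v1 + v2) = log_br u v1 + log_br u v2.
Proof. exact: jac3D. Qed.

Lemma log_brM u v1 v2 :
  log_br u (v1 * v2) = log_br u v1 * v2 + v1 * log_br u v2.
Proof. exact: jac3M. Qed.

Lemma log_brC u c : log_br u c%:MP = 0.
Proof. exact: jac3C. Qed.

(** The derivation [{X_j, u} / X_j]; it multiplies a monomial by the difference
    of two of its exponents.  Indices are taken modulo three. *)
Definition log_der (j : 'I_3) u :=
  'X_(j + 1) * u^`M(j + 1) - 'X_(j + 2) * u^`M(j + 2).

Lemma ord3_addE : ((0 + 1 = 1 :> 'I_3)%R * (0 + 2 = 2 :> 'I_3)%R *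
  (1 + 1 = 2 :> 'I_3)%R * (1 + 2 = 0 :> 'I_3)%R *
  (2 + 1 = 0 :> 'I_3)%R * (2 + 2 = 1 :> 'I_3)%R)%type.
Proof. by do !split; apply: val_inj. Qed.

Lemma log_br_var j u : log_br 'X_j u = 'X_j * log_der j u.
Proof.
rewrite /log_br jac3E !mderivM !mderiv_var /=.
by elim/forall_ord3: j; rewrite /log_der !ord3_addE /=; ring.
Qed.

Lemma mcoeff_log_der j u m :
  (log_der j u)@_m = u@_m * ((m (j + 1))%:R - (m (j + 2))%:R).
Proof. by rewrite mcoeffB !mcoeff_euler mulrBr !mulr_natr. Qed.

Lemma msize_log_der j u : (msize (log_der j u) <= msize u)%N.
Proof.
have [->|du0] := eqVneq (log_der j u) 0; first by rewrite msize0.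
rewrite -mlead_deg //; apply: msize_mdeg_lt.
have := mlead_supp du0; rewrite !mcoeff_msupp mcoeff_log_der.
by apply: contraNneq => ->; rewrite mul0r.
Qed.

(** [log_der] does not raise the degree, so the cofactor is a constant. *)
Lemma log_der_eigen j u h : u != 0 -> log_der j u = u * h -> h = (h@_0)%:MP.
Proof.
move=> u0 Eh; apply: msize1_polyC.
have [->|h0] := eqVneq h 0; first by rewrite msize0.
have := msize_log_der j u; rewrite Eh msizeM //.
move: u0; rewrite -msize_poly_eq0.
by move: (msize u) (msize h) => a b; lia.
Qed.

Lemma natr_inj : injective (fun k : nat => k%:R : L).
Proof.
move=> a b; wlog: a b / (a <= b)%N => [IH|le_ab] E.
  by case: (leqP a b) => [|/ltnW] /IH -> //.
have : (b - a)%:R == 0 :> L by rewrite natrB // E subrr.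
by rewrite (iffLR (pcharf0P L) charL0); lia.
Qed.

(** The eigenvalue [c] is the difference of the exponents of ['X_(j + 1)] and
    ['X_(j + 2)] in every monomial of [u].  A monomial free of the first
    variable makes it nonpositive, one free of the second makes it
    nonnegative. *)
Lemma log_der_eigen0 j u c : u != 0 ->
    (forall i, ~~ var_dvd i u) -> log_der j u = u * c%:MP ->
  log_der j u = 0.
Proof.
move=> u0 ndvd Ec.
have supp_eig m : m \in msupp u -> c = (m (j + 1))%:R - (m (j + 2))%:R.
  rewrite mcoeff_msupp => um0; have := mcoeff_log_der j u m.
  by rewrite Ec mulrC mcoeffCM mulrC => /(mulfI um0).
have supp_free i : exists2 m, m \in msupp u & m i = 0%N.
  by have /allPn[m um] := ndvd i; rewrite -eqn0Ngt => /eqP; exists m.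
have [m1 um1 m10] := supp_free (j + 1).
have [m2 um2 m20] := supp_free (j + 2).
have c0 : c = 0.
  have /natr_inj : (m2 (j + 1) + m1 (j + 2))%:R = 0%:R :> L.
    rewrite natrD; have := supp_eig _ um1; rewrite (supp_eig _ um2) m10 m20.
    by rewrite subr0 sub0r => ->; rewrite addNr.
  rewrite (supp_eig _ um2) m20 => /eqP.
  by rewrite addn_eq0 => /andP[/eqP-> _]; rewrite subr0.
by rewrite Ec c0 mulr0.
Qed.

Lemma mpoly_var_prime j u v w : ~~ var_dvd j u ->
  u * v = 'X_j * w -> exists h, v = 'X_j * h.
Proof.
move=> ndvd Euv.
set t := [tuple if i == j then 0 else 'X_i | i < 3] : 3.-tuple {mpoly L[3]}.
have [u1 Eu] := mpoly_var_remainder j u.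
have [v1 Ev] := mpoly_var_remainder j v.
have : (u \mPo t) * (v \mPo t) == 0.
  rewrite -rmorphM /= Euv rmorphM /= comp_mpolyXU -tnth_nth tnth_mktuple eqxx.
  by rewrite mul0r.
rewrite mulf_eq0 => /orP[] /eqP E0; last by exists v1; rewrite Ev E0 add0r.
by case/negP: ndvd; apply/var_dvdP; exists u1; rewrite {1}Eu E0 add0r.
Qed.

Lemma mpoly_var_neq0 i : 'X_i != 0 :> {mpoly L[3]}.
Proof. by rewrite -msize_poly_eq0 msizeX mdeg1. Qed.

Section Automorphisms.

Variables F G : {rmorphism {mpoly L[3]} -> {mpoly L[3]}}.
Hypothesis FC : forall c, F c%:MP = c%:MP.
Hypotheses (FK : cancel F G) (GK : cancel G F).
Hypothesis Fbr : {morph F : u v / log_br u v}.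

(** A coordinate divides all its brackets, so its image divides all brackets of
    images, that is all its own brackets, [F] being onto. *)
Lemma log_aut_normal i j :
  exists g, F 'X_i * g = 'X_j * log_der j (F 'X_i).
Proof.
exists (- F (log_der i (G 'X_j))).
rewrite -log_br_var -[in RHS](GK 'X_j) -Fbr /log_br jac3_alt -/(log_br _ _).
by rewrite log_br_var rmorphN rmorphM mulrN.
Qed.

(** The coordinate ['X_i = G (F 'X_i)] has degree one, so one factor of any
    factorization is a constant, and [G 'X_j] is not. *)
Lemma log_aut_irreducible i j q : F 'X_i = 'X_j * q -> exists c, q = c%:MP.
Proof.
move=> E; have Ei : 'X_i = G 'X_j * G q by rewrite -rmorphM -E FK.
have nz : G 'X_j * G q != 0 by rewrite -Ei mpoly_var_neq0.
move: (nz); rewrite mulf_eq0 negb_or => /andP[Xj0 q0].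
have := congr1 (fun p : {mpoly L[3]} => msize p) Ei.
rewrite msizeX mdeg1 msizeM // => sz.
have [szX|szX] := leqP (msize (G 'X_j)) 1.
  have := msize1_polyC szX => /(congr1 F); rewrite GK FC => EX.
  have := congr1 (fun p : {mpoly L[3]} => msize p) EX.
  rewrite msizeX mdeg1 msizeC; by case: (_ != 0).
exists (G q)@_0; rewrite -FC -msize1_polyC ?GK //.
by move: (msize (G 'X_j)) (msize (G q)) sz szX => a b; lia.
Qed.

(** Otherwise [F 'X_i] would be central, although its bracket with
    [F 'X_(i + 1)] is [F ('X_i * 'X_(i + 1))]. *)
Lemma log_aut_noncentral i : exists j, log_der j (F 'X_i) != 0.
Proof.
suff /existsP : [exists j, log_der j (F 'X_i) != 0] by [].
apply: contraT; rewrite negb_exists => /forallP der0.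
have br0 v : log_br (F 'X_i) v = 0.
  apply: (@derivation_eq0 3 L _ id) v => [||c|j].
  - exact: log_brD.
  - exact: log_brM.
  - exact: log_brC.
  - rewrite log_br_alt log_br_var.
    by have := der0 j; rewrite negbK => /eqP->; rewrite mulr0 oppr0.
have := br0 (F 'X_(i + 1)); rewrite -Fbr log_br_var /log_der !mderiv_var.
rewrite eqxx (_ : (i + 1 == i + 2) = false); last first.
  by elim/forall_ord3: i {der0 br0}.
rewrite mulr1 mulr0 subr0 => /eqP; rewrite -(rmorph0 F) (can_eq FK).
by rewrite mulf_eq0 !(negPf (mpoly_var_neq0 _)).
Qed.

Theorem log_aut_monomial i : exists j c, F 'X_i = c *: 'X_j.
Proof.
have U0 : F 'X_i != 0.
  by rewrite -(rmorph0 F) (can_eq FK) mpoly_var_neq0.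
have [j derj] := log_aut_noncentral i.
suff /existsP[k /var_dvdP[q Eq]] : [exists k, var_dvd k (F 'X_i)].
  have [c Ec] := log_aut_irreducible Eq; exists k, c.
  by rewrite Eq Ec mulrC mul_mpolyC.
apply: contraNT derj; rewrite negb_exists => /forallP ndvd.
have [g Eg] := log_aut_normal i j.
have [h Eh] := mpoly_var_prime (ndvd j) Eg.
have Eder : log_der j (F 'X_i) = F 'X_i * h.
  by apply: (mulfI (mpoly_var_neq0 j)); rewrite -Eg Eh; ring.
apply/eqP/(log_der_eigen0 U0 ndvd (c := h@_0)).
by rewrite -(log_der_eigen U0 Eder).
Qed.

End Automorphisms.

End LogCanonical.

(** * Diagonalization over a cube root of unity *)

Section CubeRoot.

Variables (K L : fieldType) (iota : {rmorphism K -> L}) (w : L).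
Hypothesis charK0 : [pchar K] =i pred0.
Hypothesis Ew : w ^+ 2 + w + 1 = 0.

Lemma pchar0_extension : [pchar L] =i pred0.
Proof. by move=> p; rewrite (fmorph_pchar iota) charK0. Qed.

Let w2E : w ^+ 2 = - w - 1.
Proof. by apply/eqP; rewrite -subr_eq0 -Ew; apply/eqP; ring. Qed.

(** Orthogonality of the characters of the cyclic group of order three.  The
    exponent [j.*2] stands for [- j], as [w ^+ 3 = 1]. *)
Lemma dft_orth (j k : 'I_3) :
  3%:R^-1 * \sum_(i < 3) w ^+ (i * j.*2 + i * k) = (k == j)%:R.
Proof.
have n3 := three_neq0 pchar0_extension.
have w3 : w ^+ 3 = 1 by rewrite exprS w2E mulrBr mulr1 mulrN -expr2 w2E; ring.
have w3n n : w ^+ n.+3 = w ^+ n by rewrite -addn3 exprD w3 mulr1.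
apply: (mulfI n3); rewrite mulrA divff // mul1r sum_ord3.
elim/forall_ord3: j; elim/forall_ord3: k;
  by rewrite /= ?mul0n ?mul1n ?muln0 /= ?w3n ?w2E ?expr0 ?expr1; ring.
Qed.

Section DFT.

Variables (V : lmodType L) (f : 'I_3 -> V).

(** Discrete Fourier transform of order three, and its inverse. *)
Definition dft (i : 'I_3) : V := \sum_(j < 3) w ^+ (i * j) *: f j.
Definition idft (j : 'I_3) : V :=
  3%:R^-1 *: \sum_(i < 3) w ^+ (i * j.*2) *: f i.

End DFT.

Lemma sum_delta (V : lmodType L) (f : 'I_3 -> V) j :
  \sum_k (k == j)%:R *: f k = f j.
Proof.
rewrite (bigD1 j) //= big1 => [|k /negPf->]; last by rewrite scale0r.
by rewrite eqxx scale1r addr0.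
Qed.

Lemma dftK (V : lmodType L) (f : 'I_3 -> V) : idft (dft f) =1 f.
Proof.
move=> j; rewrite /idft /dft; under eq_bigr do rewrite scaler_sumr.
rewrite exchange_big /= scaler_sumr -[RHS]sum_delta; apply: eq_bigr => k _.
rewrite -dft_orth -scalerA scaler_suml; congr (_ *: _); apply: eq_bigr => i _.
by rewrite scalerA exprD.
Qed.

Lemma idftK (V : lmodType L) (f : 'I_3 -> V) : dft (idft f) =1 f.
Proof.
move=> i; rewrite /idft /dft.
under eq_bigr do rewrite scalerA mulrC -scalerA scaler_sumr.
rewrite -scaler_sumr exchange_big /= scaler_sumr -[RHS]sum_delta.
apply: eq_bigr => k _; rewrite eq_sym -dft_orth -scalerA scaler_suml.
congr (_ *: _); apply: eq_bigr => j _.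
rewrite scalerA -exprD; congr (w ^+ _ *: _).
by rewrite addnC [(k * j.*2)%N]mulnC; lia.
Qed.

Lemma dft_linear (V W : lmodType L) (g : V -> W) (f : 'I_3 -> V) i :
  linear g -> g (dft f i) = dft (g \o f) i.
Proof.
move=> glin; pose h : {linear V -> W} :=
  HB.pack g (GRing.isLinear.Build L V W _ g glin).
by rewrite -[g]/(h : V -> W) linear_sum; apply: eq_bigr => j _; rewrite linearZ.
Qed.

Lemma idft_linear (V W : lmodType L) (g : V -> W) (f : 'I_3 -> V) i :
  linear g -> g (idft f i) = idft (g \o f) i.
Proof.
move=> glin; pose h : {linear V -> W} :=
  HB.pack g (GRing.isLinear.Build L V W _ g glin).
rewrite -[g]/(h : V -> W) linearZ linear_sum; congr (_ *: _).
by apply: eq_bigr => j _; rewrite linearZ.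
Qed.

Local Notation XL := (fun i : 'I_3 => 'X_i : {mpoly L[3]}).

(** The embedding of [K[x, y, z]] into [L[X_0, X_1, X_2]] that maps the form
    [x + w^i y + w^(2i) z] to ['X_i] ([dft_thetaX]). *)
Definition theta : {mpoly K[3]} -> {mpoly L[3]} :=
  mmap (@mpolyC 3 L \o iota) (idft XL).

HB.instance Definition _ :=
  GRing.RMorphism.copy theta (mmap (@mpolyC 3 L \o iota) (idft XL)).

Lemma thetaC c : theta c%:MP = (iota c)%:MP.
Proof. exact: mmapC. Qed.

Lemma thetaX j : theta 'X_j = idft XL j.
Proof. by rewrite /theta mmapX mmap1U. Qed.

Lemma dft_thetaX i : dft (fun j => theta 'X_j) i = 'X_i.
Proof. by rewrite -[RHS](idftK XL); apply: eq_bigr => j _; rewrite thetaX. Qed.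

(** The inverse change of coordinates: it turns [theta] into the extension of
    scalars. *)
Definition untheta : {mpoly L[3]} -> {mpoly L[3]} :=
  comp_mpoly [tuple dft XL i | i < 3].

HB.instance Definition _ :=
  GRing.LRMorphism.copy untheta (comp_mpoly [tuple dft XL i | i < 3]).

Lemma untheta_theta p : untheta (theta p) = map_mpoly iota p.
Proof.
suff: untheta \o theta =1 map_mpoly iota by apply.
apply: (@mpoly_rmorph_ext 3 K _ (untheta \o theta) (map_mpoly iota))
  => [c|j] /=.
  by rewrite thetaC map_mpolyC; apply: comp_mpolyC.
rewrite map_mpolyX thetaX idft_linear; last exact: linearP.
rewrite -[RHS](dftK XL); congr (_ *: _); apply: eq_bigr => i _ /=.
by rewrite /untheta comp_mpolyXU -tnth_nth tnth_mktuple.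
Qed.

(** The factorization of [x^3 + y^3 + z^3 - 3xyz] into the three forms
    [x + w^i y + w^(2i) z]. *)
Lemma theta_ell_C :
  theta (ell_C 1) = 3%:R^-1 *: ('X_0 * 'X_1 * 'X_2).
Proof.
have n3 := three_neq0 pchar0_extension.
rewrite -[in RHS](dft_thetaX 0) -[in RHS](dft_thetaX 1) -[in RHS](dft_thetaX 2).
rewrite /dft !sum_ord3 /= !mul0n !mul1n !expr0 !scale1r.
rewrite ell_C1E -!mul_mpolyC rmorphB !rmorphM !rmorphD !rmorphXn /=.
rewrite thetaC fmorphV rmorph_nat.
have n3M : (3%:R^-1 : L)%:MP * 3%:R = 1 :> {mpoly L[3]}.
  by rewrite -(rmorph_nat (@mpolyC 3 L)) -rmorphM mulVf.
have wM : w%:MP ^+ 2 = - w%:MP - 1 :> {mpoly L[3]}.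
  by rewrite -rmorphXn w2E rmorphB rmorphN rmorph1.
rewrite /xvar /yvar /zvar (_ : 1 %% 3 = 1)%N // expr1.
move: wM n3M; move: w%:MP_[3] (3%:R^-1)%:MP_[3] => W T wM n3M.
move: (theta _) (theta _) (theta _) => z y x.
have -> : x * y * z = T * (3%:R * x * y * z) by ring: n3M.
rewrite -mulrBr; congr (_ * _).
ring: wM.
Qed.

(** By the chain rule [c] is three times the Jacobian determinant of [theta],
    which is a constant because [theta] is a linear change of variables. *)
Lemma theta_br : exists c : L, forall u v,
  log_br (theta u) (theta v) = c *: theta (ell_br 1 u v).
Proof.
have n3 := three_neq0 pchar0_extension.
have [k Ek] : exists k, jac3 (theta 'X_0) (theta 'X_1) (theta 'X_2) = k%:MP.
  have dE j i : (theta 'X_j)^`M(i) = (3%:R^-1 * w ^+ (i * j.*2))%:MP.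
    rewrite thetaX /idft mderivZ mpolyCM mul_mpolyC; congr (_ *: _).
    rewrite raddf_sum (bigD1 i) //= big1 => [|l li]; rewrite mderivZ mderiv_var.
      by rewrite eqxx addr0 -mul_mpolyC mulr1.
    by rewrite (negPf li) scaler0.
  by rewrite jac3E !dE -!mpolyCM -!mpolyCB -!mpolyCM -!mpolyCD; eexists.
exists (3%:R * k) => u v; apply: (scalerI (invr_neq0 n3)).
rewrite scalerA mulrA mulVf // mul1r -[RHS]mul_mpolyC mulrC -Ek.
rewrite -[ell_br 1 u v]/(jac3 u v (ell_C 1)) -jac3_rmorph /=; last first.
  by move=> c j; rewrite thetaC mderivC.
by rewrite theta_ell_C jac3Zr.
Qed.

Section Lift.

(** The extension to [L[X_0, X_1, X_2]] of an endomorphism of [K[x, y, z]]: it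
    is [f] on the image of [theta] ([lift_end_theta]). *)
Definition lift_end (f : {mpoly K[3]} -> {mpoly K[3]}) :
    {mpoly L[3]} -> {mpoly L[3]} :=
  comp_mpoly [tuple dft (fun j => theta (f 'X_j)) i | i < 3].

HB.instance Definition _ f := GRing.LRMorphism.copy (lift_end f)
  (comp_mpoly [tuple dft (fun j => theta (f 'X_j)) i | i < 3]).

Lemma lift_endC f c : lift_end f c%:MP = c%:MP.
Proof. exact: comp_mpolyC. Qed.

Lemma lift_endX f i : lift_end f 'X_i = dft (fun j => theta (f 'X_j)) i.
Proof. by rewrite /lift_end comp_mpolyXU -tnth_nth tnth_mktuple. Qed.

Variables f g : {rmorphism {mpoly K[3]} -> {mpoly K[3]}}.
Hypotheses (fC : forall c, f c%:MP = c%:MP) (gC : forall c, g c%:MP = c%:MP).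

Lemma lift_end_theta p : lift_end f (theta p) = theta (f p).
Proof.
suff: lift_end f \o theta =1 theta \o f by apply.
apply: (@mpoly_rmorph_ext 3 K _ (lift_end f \o theta) (theta \o f)) => [c|j] /=.
  by rewrite thetaC lift_endC fC thetaC.
rewrite thetaX idft_linear; last exact: linearP.
rewrite -[RHS](dftK (fun j => theta (f 'X_j))); congr (_ *: _).
by apply: eq_bigr => i _ /=; rewrite lift_endX.
Qed.

Hypothesis gK : cancel g f.

Lemma lift_endK : cancel (lift_end g) (lift_end f).
Proof.
suff: lift_end f \o lift_end g =1 idfun by [].
apply: (@mpoly_rmorph_ext 3 L _ (lift_end f \o lift_end g) idfun) => [c|i] /=.
  by rewrite !lift_endC.
rewrite lift_endX dft_linear; last exact: linearP.
rewrite -[RHS]dft_thetaX; apply: eq_bigr => j _ /=.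
by rewrite lift_end_theta gK.
Qed.

Hypothesis f_br : {morph f : u v / ell_br 1 u v}.

(** The defect [D] of compatibility is a derivation along [lift_end f] in each
    argument and vanishes on the image of [theta], which spans the variables
    over [L]. *)
Lemma lift_end_br : {morph lift_end f : u v / log_br u v}.
Proof.
have [c thbr] := theta_br.
have br_theta a b : lift_end f (log_br (theta a) (theta b)) =
    log_br (lift_end f (theta a)) (lift_end f (theta b)).
  by rewrite thbr linearZ /= !lift_end_theta thbr f_br.
pose D u v := lift_end f (log_br u v) - log_br (lift_end f u) (lift_end f v).
have D0 u : (forall b, D u (theta b) = 0) -> forall v, D u v = 0.
  move=> Du0; have DD : {morph D u : p q / p + q}.
    move=> p q; rewrite /D log_brD [lift_end f (p + q)]rmorphD.
    rewrite log_brD rmorphD /=.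
    by rewrite opprD addrACA.
  have DM p q : D u (p * q) = D u p * lift_end f q + lift_end f p * D u q.
    rewrite /D log_brM [lift_end f (p * q)]rmorphM log_brM rmorphD !rmorphM /=.
    move: (lift_end f p) (lift_end f q) (lift_end f (log_br u p)) => P Q A.
    move: (lift_end f (log_br u q)) (log_br _ P) (log_br _ Q) => B A' B'.
    by ring.
  have DC a : D u a%:MP = 0.
    by rewrite /D log_brC lift_endC log_brC rmorph0 subrr.
  have DZ a p : D u (a *: p) = a *: D u p.
    by rewrite -!mul_mpolyC DM DC mul0r add0r lift_endC.
  apply: (derivation_eq0 DD DM DC) => i; rewrite -dft_thetaX dft_linear.
    by apply: big1 => j _; rewrite /= Du0 scaler0.
  by move=> a p q; rewrite DD DZ.
have Dalt u v : D u v = - D v u.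
  rewrite /D log_br_alt rmorphN /= [X in _ - X]log_br_alt.
  by rewrite opprK opprB addrC.
move=> u v; apply/eqP; rewrite -subr_eq0 -/(D u v); apply/eqP.
apply: (D0) => b; rewrite Dalt D0 ?oppr0 // => a.
by rewrite /D br_theta subrr.
Qed.

End Lift.

Section Descent.

Hypothesis no_root : forall t : K, t ^+ 2 + t + 1 <> 0.

Variables f g : {rmorphism {mpoly K[3]} -> {mpoly K[3]}}.
Hypotheses (fC : forall c, f c%:MP = c%:MP) (gC : forall c, g c%:MP = c%:MP).
Hypotheses (fK : cancel f g) (gK : cancel g f).
Hypothesis f_br : {morph f : u v / ell_br 1 u v}.

(** In the coordinates [x, y, z] over [L], a scalar multiple of some ['X_j] is a
    scalar multiple of the form with coefficients [1, w^j, w^(2j)]. *)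
Lemma untheta_lift i : exists (j : 'I_3) (c : L),
  untheta (lift_end f 'X_i) = lform (fun k => c * w ^+ (j * k)).
Proof.
have [j [c E]] := log_aut_monomial pchar0_extension (@lift_endC f)
  (lift_endK gC fK) (lift_endK fC gK) (lift_end_br fC f_br) i.
exists j, c; rewrite E linearZ /= /untheta comp_mpolyXU -tnth_nth tnth_mktuple.
by rewrite /dft scaler_sumr; apply: eq_bigr => k _; rewrite scalerA.
Qed.

Lemma map_aut_var j :
  map_mpoly iota (f 'X_j) = idft (fun i => untheta (lift_end f 'X_i)) j.
Proof.
rewrite -untheta_theta -(lift_end_theta fC) thetaX.
by rewrite !idft_linear //; exact: linearP.
Qed.

Lemma aut_var_lform j : f 'X_j = lform (fun k => (f 'X_j)@_U_(k)).
Proof.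
suff [a Ea] : exists a, map_mpoly iota (f 'X_j) = lform a.
  exact: lform_descent Ea.
rewrite map_aut_var /idft sum_ord3.
have [j0 [c0 ->]] := untheta_lift 0; have [j1 [c1 ->]] := untheta_lift 1.
have [j2 [c2 ->]] := untheta_lift 2.
by rewrite !lformZ !lformD lformZ; eexists.
Qed.

(** The image of [x + y + z] is, over [L], proportional to
    [x + w^j y + w^(2j) z].  Its coefficients lie in [K], hence so does their
    ratio [w^j]; for [j != 0] this would be a root of [t^2 + t + 1]. *)
Lemma aut_sum_var : exists2 c, c != 0 & f (\sum_j 'X_j) = c *: \sum_j 'X_j.
Proof.
have [j [c Ec]] := untheta_lift 0.
have theta_sum : theta (\sum_j 'X_j) = 'X_0.
  rewrite -dft_thetaX /dft rmorph_sum; apply: eq_bigr => k _ /=.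
  by rewrite mul0n expr0 scale1r.
have E : map_mpoly iota (f (\sum_j 'X_j)) = lform (fun k => c * w ^+ (j * k)).
  by rewrite -Ec -theta_sum lift_end_theta // untheta_theta.
have fsum_neq0 : f (\sum_j 'X_j) != 0.
  apply/eqP => /(congr1 g); rewrite fK rmorph0 => /(congr1 theta).
  by rewrite theta_sum rmorph0 => /eqP; rewrite (negPf (mpoly_var_neq0 _ _)).
have Ek k : iota (f (\sum_j 'X_j))@_U_(k) = c * w ^+ (j * k).
  by rewrite -mcoeff_map_mpoly E mcoeff_lform.
set a := (f (\sum_j 'X_j))@_U_(0).
have Ea : iota a = c by rewrite Ek muln0 mulr1.
have Ef := lform_descent E.
have c0 : c != 0.
  apply: contraNneq fsum_neq0 => c0; rewrite Ef; apply/eqP; apply: big1 => k _.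
  suff -> : (f (\sum_j 'X_j))@_U_(k) = 0 by rewrite scale0r.
  by apply: (fmorph_inj iota); rewrite Ek c0 mul0r rmorph0.
exists a; first by rewrite -(fmorph_eq0 iota) Ea.
suff j0 : j = 0.
  rewrite Ef scaler_sumr; apply: eq_bigr => k _; congr (_ *: _).
  by apply: (fmorph_inj iota); rewrite Ek Ea j0 mul0n mulr1.
pose t := (f (\sum_j 'X_j))@_U_(1) / a.
have Et : iota t = w ^+ j by rewrite fmorph_div Ea Ek muln1 mulrC mulKf.
apply/eqP; apply: contraT => jn0; case: (@no_root t).
move: Et jn0; clearbody t; clear -Ew w2E.
elim/forall_ord3: j => // Et _; apply: (fmorph_inj iota).
  by rewrite !rmorphD rmorphXn rmorph1 rmorph0 Et -[RHS]Ew expr1.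
rewrite !rmorphD rmorphXn rmorph1 rmorph0 Et -[RHS]Ew /=.
by ring: w2E.
Qed.

End Descent.
End CubeRoot.

(** * Descent to circulant automorphisms *)

Lemma cube_root_extension (K : fieldType) :
    (forall t : K, t ^+ 2 + t + 1 <> 0) ->
  exists (L : fieldType) (iota : {rmorphism K -> L}) (w : L),
    w ^+ 2 + w + 1 = 0.
Proof.
move=> no_root; pose p : {poly K} := 'X^2 + 'X + 1.
have sp : size p = 3.
  rewrite /p -addrA size_polyDl size_polyXn //.
  by rewrite size_polyDl size_polyX // size_poly1.
have irr_p : irreducible_poly p.
  apply: cubic_irreducible; first by rewrite sp.
  by move=> t; apply/negP => /rootP; rewrite !hornerE; apply: no_root.
have [L _ [w /rootP pw _]] := irredp_FAdjoin irr_p.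
exists L, (in_alg L), w; rewrite -pw.
by rewrite /p !rmorphD rmorph1 /= map_polyXn map_polyX !hornerE.
Qed.

Lemma bij_mul_morph1 (K : fieldType) (f : {mpoly K[3]} -> {mpoly K[3]}) :
  bijective f -> {morph f : p q / p * q} -> f 1 = 1.
Proof. by move=> [g fK gK] fM; rewrite -[LHS]mulr1 -{2}(gK 1) -fM mul1r gK. Qed.

(** Packs a Poisson automorphism as a morphism of [K]-algebras. *)
Lemma is_poisson_aut_rmorph (K : fieldType) br
    (f : {mpoly K[3]} -> {mpoly K[3]}) :
    @is_poisson_aut K {mpoly K[3]} br f ->
  exists F : {rmorphism {mpoly K[3]} -> {mpoly K[3]}},
    F =1 f /\ forall c, F c%:MP = c%:MP.
Proof.
case=> fbij flin fM _; have f1 := bij_mul_morph1 fbij fM.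
pose fL : {linear {mpoly K[3]} -> {mpoly K[3]}} :=
  HB.pack f (GRing.isLinear.Build K _ _ _ f flin).
have fmon : GRing.monoid_morphism f by [].
pose F : {rmorphism {mpoly K[3]} -> {mpoly K[3]}} :=
  HB.pack f fL (GRing.isMonoidMorphism.Build _ _ f fmon).
exists F; split=> // c.
by rewrite -[c%:MP]mulr1 mul_mpolyC -[LHS]/(fL (c *: 1)) linearZ /= f1.
Qed.

Lemma poisson_aut_inv (K : fieldType) br (f g : {mpoly K[3]} -> {mpoly K[3]}) :
    @is_poisson_aut K {mpoly K[3]} br f -> cancel f g -> cancel g f ->
  @is_poisson_aut K {mpoly K[3]} br g.
Proof.
case=> _ flin fM fbr fK gK; have finj := can_inj fK.
split=> [|c u v|u v|u v]; first by exists f.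
- by apply: finj; rewrite flin !gK.
- by apply: finj; rewrite fM !gK.
- by apply: finj; rewrite fbr !gK.
Qed.

Section Forward.

Variable K : fieldType.
Hypothesis charK0 : [pchar K] =i pred0.
Hypothesis no_root : forall t : K, t ^+ 2 + t + 1 <> 0.

Local Notation x := (xvar K).
Local Notation y := (yvar K).
Local Notation z := (zvar K).

(** The derivation [{x + y + z, p} / (x + y + z)]; on linear forms it is an
    infinitesimal rotation about the axis [x = y = z]. *)
Definition rot_der (p : {mpoly K[3]}) :=
  p^`M(0) * (y - z) + p^`M(1) * (z - x) + p^`M(2) * (x - y).

Lemma ell_br_sum p : ell_br 1 (x + y + z) p = (x + y + z) * rot_der p.
Proof.
have [C0 C1 C2] := ell_C_deriv 1 (three_neq0 charK0).
rewrite ell_brE C0 C1 C2 !scale1r !mderivD !mderiv_var /= /rot_der; ring.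
Qed.

Variables f g : {rmorphism {mpoly K[3]} -> {mpoly K[3]}}.
Hypotheses (fC : forall c, f c%:MP = c%:MP) (gC : forall c, g c%:MP = c%:MP).
Hypotheses (fK : cancel f g) (gK : cancel g f).
Hypothesis f_br : {morph f : u v / ell_br 1 u v}.

Lemma lform3 (a : 'I_3 -> K) : lform a = a 0 *: x + a 1 *: y + a 2 *: z.
Proof. exact: sum_ord3. Qed.

Lemma sumX3 : \sum_j 'X_j = x + y + z.
Proof. exact: sum_ord3. Qed.

(** The matrix of [f] on linear forms commutes with [rot_der] and fixes the line
    of [x + y + z].  The eigenvalues of [rot_der] being distinct, its commutant
    is spanned by its powers, which are circulant; below, the linear equations
    on the three rows [a], [b], [c] are solved by hand. *)
Lemma aut_circulant : exists k1 k2 k3, f =1 circ_subst k1 k2 k3.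
Proof.
have [L [iota [w Ew]]] := cube_root_extension no_root.
have flin := aut_var_lform iota charK0 Ew fC gC fK gK f_br.
have := aut_sum_var iota charK0 Ew no_root fC gC fK gK f_br.
case=> t t0; rewrite sumX3 => fsum.
(* Cancel [x + y + z], an eigenvector of [f], from [f {x + y + z, p}]. *)
have f_rot p : f (rot_der p) = rot_der (f p).
  have fs0 : f (x + y + z) != 0.
    rewrite fsum -sumX3 (_ : _ *: _ = lform (fun=> t)); last exact: scaler_sumr.
    apply: contraNneq t0 => /(congr1 (mcoeff U_(0))).
    by rewrite mcoeff_lform mcoeff0 => /eqP.
  apply: (mulfI fs0); rewrite -rmorphM -ell_br_sum f_br fsum -scalerAl.
  by rewrite -ell_br_sum !ell_brE !mderivZ -!mul_mpolyC; ring.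
pose a := (fun k => (f x)@_U_(k)); pose b := (fun k => (f y)@_U_(k)).
pose c := (fun k => (f z)@_U_(k)).
have [fx fy fz] : [/\ f x = lform a, f y = lform b & f z = lform c].
  by split; apply: flin.
have rot_lform (d : 'I_3 -> K) k : (rot_der (lform d))@_U_(k)
    = d (k + 2) - d (k + 1).
  pose e l := d (l + 2) - d (l + 1).
  rewrite -[RHS]/(e k) -mcoeff_lform; congr (_@__).
  rewrite !lform3 /rot_der /e !mderivD !mderivZ !mderiv_var !ord3_addE /=.
  by rewrite -!mul_mpolyC !rmorphB /=; ring.
(* [rot_der] maps [x] to [y - z] and [y] to [z - x]. *)
have Ex k : b k - c k = a (k + 2) - a (k + 1).
  rewrite -rot_lform -fx -f_rot /rot_der !mderiv_var /= !mul0r mul1r !addr0.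
  by rewrite rmorphB mcoeffB.
have Ey k : c k - a k = b (k + 2) - b (k + 1).
  rewrite -rot_lform -fy -f_rot /rot_der !mderiv_var /=.
  rewrite !mul0r mul1r addr0 add0r.
  by rewrite rmorphB mcoeffB.
have Es k : a k + b k + c k = t.
  rewrite /a /b /c -!mcoeffD -!rmorphD fsum -sumX3.
  rewrite (_ : _ *: _ = lform (fun=> t)); last exact: scaler_sumr.
  by rewrite mcoeff_lform.
have n2 := two_neq0 charK0.
have Eb2 k : 2%:R * b k = t - a k + a (k + 2) - a (k + 1).
  have -> : 2%:R * b k = (a k + b k + c k) - a k + (b k - c k) by ring.
  by rewrite Es Ex; ring.
have Ec k : c k = a (k + 1).
  apply: (mulfI n2).
  have -> : 2%:R * c k = 2%:R * (c k - a k) + 2%:R * a k by ring.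
  rewrite Ey mulrBr !Eb2 -!addrA.
  by elim/forall_ord3: k {n2}; rewrite !ord3_addE; ring.
have Eb k : b k = a (k + 2).
  by apply: (addIr (- c k)); rewrite Ex Ec.
exists (a 0), (a 1), (a 2).
have [Cx Cy Cz] := circ_substE (a 0) (a 1) (a 2).
apply: (@mpoly_rmorph_ext 3 K _ f (circ_subst (a 0) (a 1) (a 2))) => [e|i] /=.
  by rewrite fC circ_substC.
elim/forall_ord3: i; rewrite -?[X in f X]/x -?[X in f X]/y -?[X in f X]/z.
- by rewrite Cx -lform3 -fx.
- rewrite Cy fy lform3 !Eb !ord3_addE; ring.
- rewrite Cz fz lform3 !Ec !ord3_addE; ring.
Qed.

End Forward.

Theorem corollary4 (K : fieldType) (charK0 : [pchar K] =i pred0) (alpha : K)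
    (alpha3 : alpha ^+ 3 = 1)
    (no_root : ~ exists lambda : K, lambda ^+ 2 + lambda + 1 = 0)
    (phi : {mpoly K[3]} -> {mpoly K[3]}) :
  @is_poisson_aut K {mpoly K[3]} (ell_br alpha) phi <->
  exists k1 k2 k3 : K,
    k1 ^+ 3 + k2 ^+ 3 + k3 ^+ 3 - 3%:R * k1 * k2 * k3 != 0 /\
    phi =1 circ_subst k1 k2 k3.
Proof.
have no_root' (t : K) : t ^+ 2 + t + 1 <> 0.
  by move=> Et; apply: no_root; exists t.
have -> : alpha = 1.
  have /eqP : (alpha - 1) * (alpha ^+ 2 + alpha + 1) = 0.
    by rewrite -[RHS](subrr (1 : K)) -[X in _ = X - _]alpha3; ring.
  rewrite mulf_eq0 => /orP[|/eqP /no_root' //].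
  by rewrite subr_eq0 => /eqP.
split=> [aut|[k1 [k2 [k3 [N0 Ephi]]]]]; last exact: circ_subst_aut N0 Ephi.
have [psi phiK psiK] := paut_bij aut.
have [F [EF FC]] := is_poisson_aut_rmorph aut.
have [G [EG GC]] := is_poisson_aut_rmorph (poisson_aut_inv aut phiK psiK).
have FK : cancel F G by move=> p; rewrite EG EF phiK.
have GK : cancel G F by move=> p; rewrite EF EG psiK.
have Fbr : {morph F : u v / ell_br 1 u v}.
  by move=> u v; rewrite !EF (paut_br aut).
have [k1 [k2 [k3 Ek]]] := aut_circulant charK0 no_root' FC GC FK GK Fbr.
exists k1, k2, k3; split; last by move=> p; rewrite -EF Ek.
rewrite -/(circ_norm k1 k2 k3); apply/eqP => N0.
have := ell_C1_neq0 charK0; rewrite -(can_eq FK) rmorph0.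
by rewrite Ek circ_subst_ell_C // N0 scale0r eqxx.
Qed.
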